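(* Let $D$ be a connected digraph. Then $\chi_{DP}(D)\le\max\{\Delta^+(D),\Delta^-(D)\}+1$, and equality holds if and only if $D$ is (a) a directed cycle of length $\ge 2$, or (b) a bidirected cycle of length $\ge 3$, or (c) a bidirected complete graph.
   Context: Digraphs are finite, without loops and parallel arcs (opposite arcs allowed); connectivity means weak connectivity. $\Delta^+(D)$ and $\Delta^-(D)$ are the maximum out-degree and maximum in-degree. A bidirected graph is obtained from a simple undirected graph by replacing every edge with two opposite arcs. A cover of a digraph $D$ is a pair $(X,H)$: pairwise disjoint sets $X_v$ ($v\in V(D)$), and a digraph $H$ on $\bigcup_v X_v$ with each $X_v$ independent, such that for each arc $uv\in A(D)$ the arcs of $H$ from $X_u$ to $X_v$ form a (possibly empty) matching and every arc of $H$ arises in this way. An acyclic transversal is a set $T\subseteq V(H)$ with $|T\cap X_v|=1$ for all $v$ such that $H[T]$ contains no directed cycle. $D$ is DP-$k$-colorable if every cover with $|X_v|\ge k$ for all $v$ has an acyclic transversal, and the DP-chromatic number $\chi_{DP}(D)$ is the smallest $k\ge0$ such that $D$ is DP-$k$-colorable. *)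

(* Defs.v *)
(* mathcomp-classical is used only to decide Prop-valued
   DP-colorability, so that the minimum defining DPchi exists in nat. *)
From HB Require Import structures.
From mathcomp Require Import all_boot.
From mathcomp Require Import boolp.

Set Implicit Arguments.
Unset Strict Implicit.
Unset Printing Implicit Defensive.

Record digraph := Digraph {
  vertex :> finType;
  darc : rel vertex;
  darc_irr : irreflexive darc }.

Record sgraph := SGraph {
  svertex :> finType;
  edge : rel svertex;
  edge_irr : irreflexive edge;
  edge_sym : symmetric edge }.

Definition bidirected (G : sgraph) : digraph := Digraph (@edge_irr G).

(* The null digraph is not counted as connected. *)
Definition weakly_connected (D : digraph) : Prop :=
  0 < #|D| /\ forall x y : D, connect (fun u v => darc u v || darc v u) x y.

Definition outdeg (D : digraph) (v : D) : nat := #|[set w | darc v w]|.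
Definition indeg (D : digraph) (v : D) : nat := #|[set u | darc u v]|.
Definition max_outdeg (D : digraph) : nat := \max_(v : D) outdeg v.
Definition max_indeg (D : digraph) : nat := \max_(v : D) indeg v.

Definition digraph_iso (D E : digraph) : Prop :=
  exists2 f : D -> E, bijective f & forall x y, darc (f x) (f y) = darc x y.

(* ordS is the successor modulo n on 'I_n. The guard i != j only excludes the
   loop that would appear for n = 1. *)
Definition dicycle_rel n : rel 'I_n := fun i j => (i != j) && (j == ordS i).

Lemma dicycle_irr n : irreflexive (@dicycle_rel n).
Proof. by move=> i; rewrite /dicycle_rel eqxx. Qed.

Definition dicycle n : digraph := Digraph (@dicycle_irr n).

Definition cycle_rel n : rel 'I_n :=
  fun i j => dicycle_rel i j || dicycle_rel j i.

Lemma cycle_irr n : irreflexive (@cycle_rel n).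
Proof. by move=> i; rewrite /cycle_rel dicycle_irr. Qed.

Lemma cycle_sym n : symmetric (@cycle_rel n).
Proof. by move=> i j; rewrite /cycle_rel orbC. Qed.

Definition cycle_graph n : sgraph := SGraph (@cycle_irr n) (@cycle_sym n).

Definition complete_rel n : rel 'I_n := fun i j => i != j.

Lemma complete_irr n : irreflexive (@complete_rel n).
Proof. by move=> i; rewrite /complete_rel eqxx. Qed.

Lemma complete_sym n : symmetric (@complete_rel n).
Proof. by move=> i j; rewrite /complete_rel eq_sym. Qed.

Definition complete_graph n : sgraph :=
  SGraph (@complete_irr n) (@complete_sym n).

Definition independent (H : digraph) (A : {set H}) : Prop :=
  {in A &, forall x y, ~~ darc x y}.

Definition arcs_between (H : digraph) (A B : {set H}) : {set H * H} :=
  [set a | [&& a.1 \in A, a.2 \in B & darc a.1 a.2]].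

(* M is a set of arcs, given as (tail, head) pairs. *)
Definition matching (H : digraph) (M : {set H * H}) : Prop :=
  {in M &, forall a b, a != b -> [disjoint [set a.1; a.2] & [set b.1; b.2]]}.

Record DPcover (D : digraph) := Cover {
  cov_graph :> digraph;
  cov_fib : D -> {set cov_graph};
  cov_disj : forall u v, u != v -> [disjoint cov_fib u & cov_fib v];
  cov_full : forall x, exists v, x \in cov_fib v;
  cov_indep : forall v, independent (cov_fib v);
  cov_match : forall u v, darc u v ->
    matching (arcs_between (cov_fib u) (cov_fib v));
  cov_arc : forall x y : cov_graph, darc x y ->
    exists u v, [/\ darc u v, x \in cov_fib u & y \in cov_fib v] }.

(* A directed cycle of H[T] is given by the nonempty
   duplicate-free cyclic sequence of its vertices. *)
Definition acyclic_on (H : digraph) (T : {set H}) : Prop :=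
  forall p : seq H, p != [::] -> {subset p <= T} -> ~ ucycle (@darc H) p.

Definition acyclic_transversal (D : digraph) (C : DPcover D) (T : {set C}) :
    Prop :=
  (forall v, #|T :&: cov_fib C v| = 1) /\ acyclic_on T.

Definition DP_colorable (D : digraph) (k : nat) : Prop :=
  forall C : DPcover D, (forall v, k <= #|cov_fib C v|) ->
    exists T : {set C}, acyclic_transversal T.

Lemma cov_fib_inj (D : digraph) (C : DPcover D) (w : D) (z : C) (w' : D) :
  z \in cov_fib C w -> z \in cov_fib C w' -> w = w'.
Proof.
move=> zw zw'; apply/eqP; apply/negPn/negP=> /(@cov_disj _ C)/disjointFr/(_ zw).
by rewrite zw'.
Qed.

Lemma cov_nbr (D : digraph) (C : DPcover D) (x : C) (v : D) :
  #|[set y in cov_fib C v | darc x y || darc y x]| <= 2.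
Proof.
have [u xu] := cov_full x.
have -> : [set y in cov_fib C v | darc x y || darc y x] =
  [set y in cov_fib C v | darc x y] :|: [set y in cov_fib C v | darc y x].
  by apply/setP=> y; rewrite !inE -andb_orr.
apply: leq_trans (leq_card_setU _ _) _; apply: (@leq_add _ _ 1 1).
  apply/card_le1_eqP=> y z; rewrite !inE => /andP[yv xy] /andP[zv xz].
  have [u1 [v1 [a1 xu1 yv1]]] := cov_arc xy.
  move: a1; rewrite -(cov_fib_inj xu xu1) -(cov_fib_inj yv yv1) => a.
  apply/eqP; apply/negPn/negP; rewrite eq_sym => nyz.
  have := @cov_match _ C _ _ a (x, y) (x, z).
  rewrite !inE /= xu yv zv xy xz => /(_ isT isT).
  rewrite xpair_eqE eqxx ?andbT nyz => /(_ isT) /disjointFr/(_ (set21 _ _)).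
  by rewrite !inE eqxx.
apply/card_le1_eqP=> y z; rewrite !inE => /andP[yv xy] /andP[zv xz].
have [u1 [v1 [a1 yv1 xu1]]] := cov_arc xy.
move: a1; rewrite -(cov_fib_inj xu xu1) -(cov_fib_inj yv yv1) => a.
apply/eqP; apply/negPn/negP; rewrite eq_sym => nyz.
have := @cov_match _ C _ _ a (y, x) (z, x).
rewrite !inE /= xu yv zv xy xz => /(_ isT isT).
rewrite xpair_eqE eqxx ?andbT nyz => /(_ isT) /disjointFr/(_ (set22 _ _)).
by rewrite !inE eqxx orbT.
Qed.

Lemma DP_colorable_large (D : digraph) : DP_colorable D (#|D|.*2).+1.
Proof.
move=> C leC.
suff: forall s : seq D, uniq s -> exists T : {set C},
    [/\ #|T| <= size s, forall x, x \in T -> exists2 v, v \in s & x \in cov_fib C v,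
        independent T & forall v, v \in s -> #|T :&: cov_fib C v| = 1].
  move/(_ (enum D) (enum_uniq _)) => [T [_ _ indT T1]]; exists T; split.
    by move=> v; apply: T1; rewrite mem_enum.
  case=> [//|x p] _ sT /andP[/= + _].
  have xT : x \in T by apply: sT; rewrite mem_head.
  case: p sT => [|y p] sT /=; first by rewrite darc_irr.
  by rewrite (negPf (indT _ _ xT _)) //; apply: sT; rewrite !inE eqxx orbT.
elim=> [_|v s IH /= /andP[vs us]].
  exists set0; split=> //; first by rewrite cards0.
    by move=> x; rewrite inE.
  by move=> x y; rewrite inE.
have [T [cT inT indT T1]] := IH us.
pose bad := \bigcup_(t in T) [set y in cov_fib C v | darc t y || darc y t].
have cbad : #|bad| <= #|D|.*2.
  apply: (@leq_trans (\sum_(t in T) 2)).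
    rewrite /bad; elim/big_rec2: _ => [|t n B _ IHb]; first by rewrite cards0.
    by apply: leq_trans (leq_card_setU _ _) _; apply: leq_add => //; apply: cov_nbr.
  rewrite sum_nat_const muln2 leq_double (leq_trans cT) //.
  by rewrite -(card_uniqP us) max_card.
have /card_gt0P[y] : 0 < #|cov_fib C v :\: bad|.
  rewrite cardsD subn_gt0; apply: leq_trans (leC v); rewrite ltnS.
  by apply: leq_trans cbad; rewrite subset_leq_card // subsetIr.
rewrite inE => /andP[ybad yv].
have Ty t : t \in T -> ~~ darc t y && ~~ darc y t.
  move=> tT; rewrite -negb_or; apply: contra ybad => h.
  by apply/bigcupP; exists t => //; rewrite inE yv h.
exists (y |: T); split.
- by rewrite cardsU1; case: (y \in T) => //=; rewrite ?add0n ?add1n ?ltnS // ltnW.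
- move=> x; rewrite !inE => /orP[/eqP->|/inT[w ws xw]].
    by exists v; rewrite ?mem_head.
  by exists w; rewrite // inE ws orbT.
- move=> a b; rewrite !inE => /orP[/eqP->|aT] /orP[/eqP->|bT].
  + by rewrite darc_irr.
  + by case/andP: (Ty _ bT).
  + by case/andP: (Ty _ aT).
  + exact: indT.
move=> w; rewrite inE => /orP[/eqP->|ws].
  have -> : (y |: T) :&: cov_fib C v = [set y]; last by rewrite cards1.
  apply/setP=> z; rewrite !inE; case: eqP => [->|_] //=.
  apply/negP=> /andP[/inT[w' ws zw'] zv].
  by move: vs; rewrite -(cov_fib_inj zw' zv) ws.
rewrite -(T1 w ws); congr #|pred_of_set _|; apply/setP=> z; rewrite !inE.
case: eqP => [->|_] //=; case: (boolP (y \in cov_fib C w)) => [yw|_].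
  by move: vs; rewrite (cov_fib_inj yv yw) ws.
by rewrite andbF.
Qed.

Lemma DPchi_subproof (D : digraph) : exists k, `[< DP_colorable D k >].
Proof. by exists (#|D|.*2).+1; apply/asboolP/DP_colorable_large. Qed.

Definition DPchi (D : digraph) : nat := ex_minn (DPchi_subproof D).

(* Main.v *)
Require Import Defs.
From mathcomp Require Import all_boot.
From mathcomp Require Import boolp.

(* Take a cover without acyclic transversal whose fibres have at least
   k = max(Delta^+, Delta^-) elements. Colouring greedily towards a vertex v
   gives an acyclic selection off v (v is its hole); as no colour of v is free,
   the out-neighbours of v, and likewise its in-neighbours, are matched with the
   colours of v. Hence D is k-diregular and the hole can be moved to any
   neighbour of v.

   Let v, p lie in a set M of vertices with M - v connected, and let v be an
   in-neighbour (resp. out-neighbour) of p. Moving the hole from v into M - v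
   and then through M - v to p injects the neighbours of v in M, on either side,
   into the in-neighbours (resp. out-neighbours) of p in M. Applied in both
   directions to adjacent vertices of 2-connected induced subgraphs, this makes
   their degrees agree, and the rest is graph theory: D has no cut vertex; a
   shortest directed cycle of length at least 3 induces a regular 2-connected
   subgraph, which either is all of D or forces D to be complete.

   For the lower bounds, complete digraphs and dicycles use the cover
   D x {0..k-1}, and bidirected cycles the cover whose matchings exchange the
   two colours except between the two ends of an enumeration of the cycle. *)

Set Implicit Arguments.
Unset Strict Implicit.
Unset Printing Implicit Defensive.

(** * Connected vertex sets *)

(* The arc relation, reversed when [b] is false; the in- and out-versions of
   every statement below are its two instances. *)
Definition dir (T : Type) (e : rel T) (b : bool) : rel T :=
  fun x y => if b then e x y else e y x.

Lemma dirNE (T : Type) (e : rel T) b x y : dir e (~~ b) x y = dir e b y x.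
Proof. by case: b. Qed.

(** Choosing a related element for each [x] gives an injection. Its values lie in [option B], so
    that it is total even when [B] is empty. *)
Lemma leq_card_rel (A B : finType) (S : {set A}) (R : {set B})
    (r : A -> B -> Prop) :
  (forall x, x \in S -> exists2 y, y \in R & r x y) ->
  (forall x x' y, x \in S -> x' \in S -> r x y -> r x' y -> x = x') ->
  #|S| <= #|R|.
Proof.
move=> ex inj.
have /choice[f fP] x : exists o : option B, x \in S ->
    exists2 y, y \in R & o = Some y /\ r x y.
  case: (boolP (x \in S)) => [/ex[y yR rxy]|_]; last by exists None.
  by exists (Some y) => _; exists y.
rewrite -(card_in_imset (f := f) (D := S)); last first.
  move=> x x' xS x'S.
  have [y _ [-> rxy]] := fP x xS; have [y' _ [-> rxy']] := fP x' x'S.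
  by case=> eqy; move: rxy' ; rewrite -eqy; apply: inj.
rewrite -(card_imset R Some_inj); apply: subset_leq_card.
apply/subsetP=> _ /imsetP[x xS ->]; have [y yR [-> _]] := fP x xS.
exact: imset_f.
Qed.

Section ConnectedSets.
Variables (T : finType) (e : rel T).
Implicit Types (A B M Q : {set T}) (x y z : T).

Definition adj : rel T := fun x y => e x y || e y x.

Lemma adjC x y : adj x y = adj y x.
Proof. by rewrite /adj orbC. Qed.

Lemma adj_dir x y : adj x y -> exists b, dir e b x y.
Proof. by case/orP; [exists true|exists false]. Qed.

Lemma dir_adj b x y : dir e b x y -> adj x y.
Proof. by rewrite /adj; case: b => /= ->; rewrite ?orbT. Qed.

(** Connectedness of the underlying graph induced on [M], in cut form: it then acts as an induction
    principle through [conn_closed]. The empty set counts as connected. *)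
Definition conn M := forall A, A \subset M -> A != set0 -> A != M ->
  exists x y, [/\ x \in A, y \in M, y \notin A & adj x y].

Lemma conn_closed M A : conn M -> A \subset M -> A != set0 ->
  (forall x y, x \in A -> y \in M -> adj x y -> y \in A) -> A = M.
Proof.
move=> cM AM A0 clA; apply/eqP/negPn/negP=> AneM.
have [x [y [xA yM /negP yA xy]]] := cM A AM A0 AneM.
exact/yA/(clA x).
Qed.

Lemma not_connP M x : ~ conn M -> exists A,
  [/\ A \subset M, A != set0, A != M, x \notin A &
      forall y z, y \in A -> z \in M -> adj y z -> z \in A].
Proof.
move=> ncM.
have [A [AM A0 AneM clA]] : exists A, [/\ A \subset M, A != set0, A != M &
    forall y z, y \in A -> z \in M -> adj y z -> z \in A].
  apply: contrapT => nA; apply: ncM => A AM A0 AneM.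
  apply: contrapT => nxy; apply: nA; exists A; split=> // y z yA zM yz.
  by apply/negPn/negP=> zA; apply: nxy; exists y, z.
case: (boolP (x \in A)) => xA; last by exists A.
(* When [x] lies in [A], the other side of the cut is taken. *)
exists (M :\: A); split.
- exact: subsetDl.
- by rewrite setD_eq0; apply: contra AneM => MA; rewrite eqEsubset AM.
- apply/eqP=> eqM; case/set0Pn: A0 => y yA.
  by have := subsetP AM y yA; rewrite -eqM inE yA.
- by rewrite inE xA.
move=> y z; rewrite !inE => /andP[yA yM] zM yz; rewrite zM andbT.
by apply: contra yA => zA; apply: (clA z); rewrite // adjC.
Qed.

Lemma conn1 x : conn [set x].
Proof.
move=> A; rewrite subset1 => /orP[/eqP->|/eqP->]; first by rewrite eqxx.
by rewrite eqxx.
Qed.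

Lemma connU A B x y : conn A -> conn B -> x \in A -> y \in B -> adj x y ->
  conn (A :|: B).
Proof.
move=> cA cB xA yB xy; apply: contrapT => /(@not_connP _ x)[S].
move=> [SM S0 SneM xS clS].
have SA0 : S :&: A = set0.
  apply/eqP/negPn/negP=> SA0; move/negP: xS; apply.
  suff SA : S :&: A = A by move: xA; rewrite -SA => /setIP[].
  apply: conn_closed => // [|u v]; first exact: subsetIr.
  rewrite !inE => /andP[uS _] vA uv; rewrite vA andbT.
  by apply: (clS u) => //; rewrite inE vA.
have SB : S \subset B.
  apply/subsetP=> u uS; have := subsetP SM u uS.
  by rewrite inE; case/orP=> // uA; have := in_set0 u; rewrite -SA0 inE uS uA.
have yS : y \in S.
  suff -> : S = B by [].
  apply: conn_closed => // u v uS vB; apply: clS => //; by rewrite inE vB orbT.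
have : x \in S by apply: (clS y) => //; rewrite ?inE ?xA // adjC.
by rewrite (negPf xS).
Qed.

(** A maximal connected proper subset misses a single vertex, since attaching an adjacent vertex
    keeps it connected. *)
Lemma conn_noncut Q : conn Q -> 1 < #|Q| ->
  exists2 q, q \in Q & conn (Q :\ q).
Proof.
move=> cQ Q1; have /card_gt0P[x xQ] : 0 < #|Q| by apply: ltnW.
pose P A := `[< conn A >] && (A \proper Q).
have Px : P [set x].
  rewrite /P; apply/andP; split; first by apply/asboolP/conn1.
  by rewrite properEcard sub1set xQ cards1.
have [A /maxsetP[/andP[/asboolP cA AQ] maxA] xA] := maxset_exists Px.
have [u [v [uA vQ vA uv]]] : exists u v,
    [/\ u \in A, v \in Q, v \notin A & adj u v].
  apply: cQ; first exact: proper_sub.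
    by apply/set0Pn; exists x; rewrite -sub1set.
  by move: AQ; rewrite properEneq => /andP[].
have cAv : conn (A :|: [set v]).
  by apply: (connU cA (@conn1 v) uA _ uv); rewrite inE.
exists v => //; have <- : A :|: [set v] = Q.
  apply/eqP; rewrite eqEsubset subUset sub1set vQ (proper_sub AQ) /=.
  apply/negPn/negP=> nQ; have : A :|: [set v] = A.
    apply: maxA; last exact: subsetUl.
    apply/andP; split; first exact/asboolP.
    by rewrite properE nQ subUset sub1set vQ (proper_sub AQ).
  by move/setP/(_ v); rewrite !inE eqxx orbT (negPf vA).
suff -> : (A :|: [set v]) :\ v = A by [].
apply/setP=> z; rewrite !inE; case: eqP => [->|_] /=.
  by rewrite (negPf vA).
by rewrite orbF.
Qed.

Lemma conn_path x q : path e x q -> conn [set y in x :: q].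
Proof.
elim: q x => [|y q IH] x /=.
  move=> _; suff -> : [set y in [:: x]] = [set x] by apply: conn1.
  by apply/setP=> z; rewrite !inE.
case/andP=> xy /IH cq.
have -> : [set z in x :: y :: q] = [set x] :|: [set z in y :: q].
  by apply/setP=> z; rewrite !inE.
by apply: (connU (@conn1 x) cq (x := x) (y := y)); rewrite ?inE ?eqxx // /adj xy.
Qed.

Lemma conn_component M x : x \in M -> exists K : {set T},
  [/\ x \in K, K \subset M, conn K &
      forall y z, y \in K -> z \in M -> adj y z -> z \in K].
Proof.
move=> xM; pose P A := `[< conn A >] && (A \subset M).
have Px : P [set x] by rewrite /P sub1set xM andbT; apply/asboolP/conn1.
have [K /maxsetP[/andP[/asboolP cK KM] maxK]] := maxset_exists Px.
rewrite sub1set => xK; exists K; split=> // y z yK zM yz.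
suff <- : K :|: [set z] = K by rewrite !inE eqxx orbT.
apply: maxK; last exact: subsetUl.
rewrite /P subUset KM sub1set zM !andbT; apply/asboolP.
by apply: (connU cK (@conn1 z) yK _ yz); rewrite inE.
Qed.

End ConnectedSets.

(** * Regularity from monotone degrees *)

(** By the convention of [dir], [true] gives in-neighbours and [false] out-neighbours. *)
Definition nb (T : finType) (e : rel T) b v := [set u | dir e b u v].
Definition deg (T : finType) (e : rel T) b (M : {set T}) v :=
  #|nb e b v :&: M|.

(** Besides regularity, the only consequence of uncolorability passed on to the graph theory. The
    side [b] at [v] is independent of the direction [b'] of the arc. *)
Definition deg_monotone (T : finType) (e : rel T) :=
  forall b b' (M : {set T}) v p, v \in M -> p \in M -> conn e (M :\ v) ->
  dir e b' v p -> deg e b M v <= deg e b' M p.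

Section DegMonotone.
Variables (T : finType) (e : rel T).
Hypotheses (e_irr : irreflexive e) (e_mono : deg_monotone e).
Implicit Types (A K M Q S Z : {set T}) (x y z u v : T).
Local Notation adj := (adj e).
Local Notation dir := (dir e).
Local Notation deg := (deg e).
Local Notation nb := (nb e).
Local Notation conn := (conn e).

(** Both sums count the arcs inside [M]. *)
Lemma sum_deg M : \sum_(z in M) deg true M z = \sum_(z in M) deg false M z.
Proof.
have degE b z : deg b M z = \sum_(u in M) dir b u z.
  rewrite -big_mkcondr /= sum1_card; apply: eq_card => u.
  by rewrite !inE andbC.
under eq_bigr do rewrite degE; under [RHS]eq_bigr do rewrite degE.
by rewrite exchange_big.
Qed.

(* For adjacent [x], [y] both inequalities of [e_mono] apply, which forces all
   the degrees involved to agree. *)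
Lemma deg_const M Z : Z \subset M -> conn Z ->
  (forall z, z \in Z -> conn (M :\ z)) ->
  (forall b z, z \in Z -> 0 < deg b Z z) ->
  exists r, forall b z, z \in Z -> deg b M z = r.
Proof.
move=> ZM cZ cM dZ; have inM z : z \in Z -> z \in M by apply: subsetP.
case: (set_0Vmem Z) => [Z0|[x xZ]]; first by exists 0 => b z; rewrite Z0 inE.
have eqd b b' z : z \in Z -> deg b M z = deg b' M z.
  suff led c c' : z \in Z -> deg c M z <= deg c' M z.
    by move=> zZ; apply/eqP; rewrite eqn_leq !led.
  (* Go from [z] to a neighbour [y] and back: an arc dictates the side at its target only, so one
     may leave on side [c] and return on side [c']. *)
  move=> zZ; have /card_gt0P[y] := dZ c' z zZ; rewrite !inE => /andP[yz yZ].
  apply: (@leq_trans (deg (~~ c') M y)).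
    by apply: e_mono; rewrite ?inM ?dirNE //; apply: cM.
  by apply: e_mono; rewrite ?inM //; apply: cM.
exists (deg true M x) => b z zZ; rewrite (eqd b true z zZ).
have leqd y y' : y \in Z -> y' \in Z -> adj y y' ->
    deg true M y <= deg true M y'.
  move=> yZ y'Z /adj_dir[c yy']; rewrite [X in _ <= X](eqd true c y' y'Z).
  by apply: e_mono; rewrite ?inM //; apply: cM.
suff : z \in [set y in Z | deg true M y == deg true M x].
  by rewrite inE => /andP[_ /eqP].
suff -> : [set y in Z | deg true M y == deg true M x] = Z by [].
apply: (conn_closed cZ); first by apply/subsetP=> y; rewrite inE => /andP[].
  by apply/set0Pn; exists x; rewrite inE xZ eqxx.
move=> y y'; rewrite !inE => /andP[yZ /eqP <-] y'Z yy'; rewrite y'Z /=.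
by rewrite eqn_leq !leqd // adjC.
Qed.

(** * Connected regular digraphs with monotone degrees *)

Section Connected.
Variable k : nat.
Hypotheses (e_reg : forall b v, #|nb b v| = k) (connT : conn setT).

Lemma deg_subset b M x : nb b x \subset M -> deg b M x = k.
Proof. by move=> sM; rewrite /deg (setIidPl sM) e_reg. Qed.

Lemma nb_subset b M x : deg b M x = k -> nb b x \subset M.
Proof.
move=> dk; apply/setIidPl/eqP; rewrite eqEcard subsetIl /=.
by rewrite e_reg -[X in X <= _]dk.
Qed.

Definition separates x K := [/\ x \notin K, K != set0, x |: K != setT &
  forall y z, y \in K -> adj y z -> z \in x |: K].

(* A smallest piece [K] cut off by a vertex [x] induces with [x] a graph
   without cut vertices, so the degree of [x] in [x |: K] is [k] and nothing is
   left outside. *)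
Lemma no_separation x K : ~ separates x K.
Proof.
have [n leKn] := ubnP #|K|; elim: n => // n IH in x K leKn *.
move=> [xK K0 xKT clK]; set M := x |: K in xKT clK.
have inM y : y \in K -> y \in M by rewrite inE => ->; rewrite orbT.
(* A cut vertex [y] in [K] would cut off a piece avoiding [x], hence inside [K :\ y], against the
   minimality of [K]. *)
have cM y : y \in K -> conn (M :\ y).
  move=> yK; apply: contrapT => /(@not_connP _ _ _ x)[A [AM A0 AneM xA clA]].
  have AK : A \subset K :\ y.
    apply/subsetP=> z zA; have := subsetP AM z zA; rewrite !inE.
    by case: (z =P x) xA => [<-|_]; rewrite ?zA.
  case: (IH y A).
    rewrite -ltnS; apply: leq_trans leKn; rewrite !ltnS.
    by rewrite [X in _ < X](cardsD1 y) yK ltnS subset_leq_card.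
  split=> //.
  - by apply/negP=> /(subsetP AK); rewrite !inE eqxx.
  - apply/eqP=> /setP/(_ x); rewrite !inE (negPf xA) orbF.
    by case: eqP => // xy; rewrite xy yK in xK.
  move=> z w zA zw; have := subsetP AK z zA; rewrite inE => /andP[_ zK].
  rewrite in_setU1; case: (w =P y) => //= /eqP wy; apply: (clA z) => //.
  by rewrite in_setD1 wy; apply: clK zw.
have dK b y : y \in K -> deg b M y = k.
  move=> yK; apply: deg_subset; apply/subsetP=> z; rewrite inE => /dir_adj zy.
  by apply: clK yK _; rewrite adjC.
have [y [z [yK _ zK yz]]] : exists y z,
    [/\ y \in K, z \in setT, z \notin K & adj y z].
  apply: connT => //.
  by apply/eqP=> KT; rewrite KT inE in xK.
have {zK} zx : z = x.
  by apply/eqP; have := clK y z yK yz; rewrite !inE (negPf zK) orbF.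
rewrite {z}zx in yz; have [b yx] := adj_dir yz.
have xM : x \in M by rewrite !inE eqxx.
have dx : deg b M x = k.
  apply/eqP; rewrite eqn_leq; apply/andP; split.
    by rewrite -(e_reg b x); apply: subset_leq_card; apply: subsetIl.
  by rewrite -(dK b y yK); exact: (e_mono b (inM y yK) xM (cM y yK) yx).
(* All other vertices of [M] have both degrees [k] in [M], so counting arcs balances the two degrees
   of [x]. *)
have dxn : deg true M x = deg false M x.
  have := sum_deg M; rewrite !big_setU1 //= => /eqP.
  under eq_bigr do rewrite dK //; under [in X in _ == X]eq_bigr do rewrite dK //.
  by rewrite eqn_add2r => /eqP.
have {}dx c : deg c M x = k by case: c; case: b dx {yx} => <-.
case/eqP: xKT; apply: (conn_closed connT); first exact: subsetT.
  by apply/set0Pn; exists x.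
move=> u v uM _ uv; move: uM; rewrite in_setU1 => /orP[/eqP ux|uK].
  move: uv; rewrite ux adjC => /adj_dir[c vx].
  by apply: (subsetP (nb_subset (dx c))); rewrite inE.
exact: clK uv.
Qed.

Lemma no_cutvertex x : conn (setT :\ x).
Proof.
apply: contrapT => /(@not_connP _ _ _ x)[A [Ax A0 AneT xA clA]].
apply: (@no_separation x A); split=> //.
  apply/eqP=> AT; case/eqP: AneT; apply/eqP; rewrite eqEsubset Ax /=.
  apply/subsetP=> y; rewrite -AT !inE => /andP[/negPf-> //].
move=> y z yA yz; rewrite in_setU1; case: eqP => //= /eqP zx.
by apply: (clA y) => //; rewrite !inE zx.
Qed.

(** Shared by directed cycles, where the growth of [Z] starts, and cliques, through which it
    continues. Three vertices are what the pigeonhole step of [biconn_extend] uses. *)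
Definition regular_biconn Z :=
  [/\ 2 < #|Z|, conn Z, forall z, z \in Z -> conn (Z :\ z) & exists2 r, 0 < r & forall b z, z \in Z -> deg b Z z = r].

Lemma clique_regular_biconn Z : 2 < #|Z| ->
  {in Z &, forall x y, x != y -> e x y} -> regular_biconn Z.
Proof.
move=> Z3 eZ; have cZ S : S \subset Z -> conn S.
  move=> SZ A AS /set0Pn[x xA] AneS.
  have /properP[_ [y yS yA]] : A \proper S by rewrite properEneq AneS.
  have xS := subsetP AS x xA; exists x, y; split=> //; apply/orP; left.
  apply: eZ; [exact: (subsetP SZ)|exact: (subsetP SZ)|].
  by apply: contraNneq yA => <-.
split=> //; first exact: cZ.
  by move=> z _; apply/cZ/subsetDl.
exists #|Z|.-1; first by case: #|Z| Z3 => [|[]].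
move=> b z zZ; rewrite [in RHS](cardsD1 z) zZ /=; apply: eq_card => u.
rewrite !inE; case: (u =P z) => [->|/eqP uz].
  by rewrite /dir; case: b; rewrite e_irr.
rewrite /=; case: (boolP (u \in Z)) => uZ; rewrite ?andbF // andbT.
by rewrite /dir; case: b; rewrite eZ // eq_sym.
Qed.

(* [Q] is a smallest connected set outside [Z] attached to two vertices of [Z].
   By [deg_const] every vertex of [Z] is attached to [Q], whence [Q] is a single
   vertex. *)
Lemma biconn_extend Z : regular_biconn Z -> Z != setT ->
  exists2 u, u \notin Z & {in u |: Z &, forall x y, x != y -> e x y}.
Proof.
move=> [Z3 cZ cZ1 [r r0 dZ]] ZT.
pose N Q := [set z in Z | [exists q in Q, adj q z]].
pose P Q := [&& `[< conn Q >], [disjoint Q & Z] & 1 < #|N Q|].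
(* A component of the complement of [Z] qualifies: attached to at most one vertex [z], it would be
   all of [setT :\ z], which contains further vertices of [Z]. *)
have [K PK] : exists K, P K.
  have [x] : exists x, x \in ~: Z.
    by apply/set0Pn; apply: contra ZT => /eqP ZC0; rewrite -(setCK Z) ZC0 setC0.
  move=> /(conn_component e)[K [xK KZ cK clK]]; exists K.
  apply/and3P; split; first exact/asboolP.
    by rewrite disjoints_subset.
  rewrite ltnNge; apply/negP=> N1.
  have [z zZ Nz] : exists2 z, z \in Z & N K \subset [set z].
    case: (set_0Vmem (N K)) => [->|[z zN]].
      have /card_gt0P[z zZ] : 0 < #|Z| by apply: leq_trans Z3.
      by exists z; rewrite ?sub0set.
    exists z; first by move: zN; rewrite inE => /andP[].
    by apply/subsetP=> y yN; rewrite inE; apply/eqP; apply: (card_le1_eqP N1).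
  have : K = setT :\ z.
    apply: (conn_closed (@no_cutvertex z)).
    - apply/subsetP=> y yK; rewrite !inE andbT; apply: contraL zZ => /eqP <-.
      by have := subsetP KZ y yK; rewrite inE.
    - by apply/set0Pn; exists x.
    move=> y w yK; rewrite !inE andbT => wz yw.
    case: (boolP (w \in Z)) => wZ; last by apply: (clK y) => //; rewrite inE.
    have : w \in N K.
      by rewrite inE wZ; apply/existsP; exists y; rewrite yK.
    by move/(subsetP Nz); rewrite inE (negPf wz).
  have /card_gt0P[y] : 0 < #|Z :\ z|.
    by move: Z3; rewrite (cardsD1 z) zZ; case: #|_|.
  rewrite !inE => /andP[yz yZ] /setP/(_ y); rewrite !inE yz /= => yK.
  by have := subsetP KZ y yK; rewrite inE yZ.
have [Q PQ minQ] := arg_minnP (fun Q : {set T} => #|Q|) PK.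
case/and3P: PQ => /asboolP cQ QZ N2.
have notZ q : q \in Q -> q \notin Z by move=> qQ; rewrite (disjointFr QZ qQ).
have [w wN] : exists w, w \in N Q by apply/card_gt0P; apply: ltnW.
have wZ : w \in Z by move: wN; rewrite inE => /andP[].
(* As [Q] is attached to a vertex of [Z] other than [z], it remains linked to [Z :\ z]. *)
have cM z : z \in Z -> conn ((Z :|: Q) :\ z).
  move=> zZ; have [y yN yz] : exists2 y, y \in N Q & y != z.
    have /card_gt0P[y] : 0 < #|N Q :\ z|.
      by move: N2; rewrite (cardsD1 z); case: (_ \in _); case: #|_|.
    by rewrite in_setD1 => /andP[yz yN]; exists y.
  move: yN; rewrite inE => /andP[yZ /existsP[q /andP[qQ qy]]].
  have -> : (Z :|: Q) :\ z = Z :\ z :|: Q.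
    rewrite setDUl; congr (_ :|: _); apply/setDidPl.
    by rewrite disjoint_sym disjoints1; apply: contraL zZ => /notZ.
  by apply: (connU (cZ1 z zZ) cQ _ qQ (x := y)); rewrite ?inE ?yz // adjC.
have [R dM] : exists R, forall b z, z \in Z -> deg b (Z :|: Q) z = R.
  apply: deg_const => //; first exact: subsetUl.
  by move=> b z zZ; rewrite dZ.
have degU b z : z \in Z -> R = r + #|nb b z :&: Q|.
  move=> zZ; rewrite -(dM b z zZ) /deg setIUr cardsU -(dZ b z zZ).
  rewrite [X in _ - X]eq_card0 ?subn0 // => u; rewrite !inE.
  by case: (boolP (u \in Q)) => [/notZ/negPf->|]; rewrite !andbF.
(* Every vertex of [Z] has [R - r] neighbours in [Q] on each side; this number is positive at [w],
   hence everywhere. *)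
have rR : r < R.
  move: wN; rewrite inE => /andP[_ /existsP[q /andP[qQ /adj_dir[b qw]]]].
  rewrite (degU b w wZ) -[X in X < _]addn0 ltn_add2l; apply/card_gt0P.
  by exists q; rewrite !inE qw.
have attached b z : z \in Z -> exists2 q, q \in Q & dir b q z.
  move=> zZ; move: rR; rewrite (degU b z zZ) -[X in X < _]addn0 ltn_add2l.
  by case/card_gt0P=> q; rewrite !inE => /andP[qz qQ]; exists q.
have [u Qu] : exists u, Q = [set u].
  apply/cards1P; rewrite eqn_leq; apply/andP; split; last first.
    by have [q qQ _] := attached true w wZ; apply/card_gt0P; exists q.
  (* By minimality [Q :\ q] is attached to at most one vertex of [Z]. The other vertices, at least
     two, are attached to [q], so [[set q]] would be a smaller choice. *)
  rewrite leqNgt; apply/negP=> Q2; have [q qQ cQq] := conn_noncut cQ Q2.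
  have N1 : #|N (Q :\ q)| <= 1.
    rewrite leqNgt; apply/negP=> N1.
    have : P (Q :\ q).
      apply/and3P; split=> //; first exact/asboolP.
      by apply: disjointWl QZ; apply: subsetDl.
    by move/minQ; rewrite [X in X <= _](cardsD1 q) qQ ltnn.
  have : P [set q].
    apply/and3P; split; first exact/asboolP/conn1.
      by rewrite disjoints1 notZ.
    rewrite -(leq_add2l 1); apply: (leq_trans Z3).
    apply: leq_trans (leq_add N1 (leqnn _)).
    apply: leq_trans (leq_card_setU _ _); apply: subset_leq_card.
    apply/subsetP=> z zZ; have [q' q'Q /dir_adj q'z] := attached true z zZ.
    rewrite !inE zZ /=; case: (q' =P q) => [<-|/eqP q'q].
      by apply/orP; right; apply/existsP; exists q'; rewrite inE eqxx.
    by apply/orP; left; apply/existsP; exists q'; rewrite !inE q'q q'Q.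
  by move/minQ; rewrite cards1 leqNgt Q2.
have uz b z : z \in Z -> dir b u z.
  by move/(attached b)=> [q]; rewrite Qu inE => /eqP->.
have uZ : u \notin Z by apply: notZ; rewrite Qu inE.
have Rr : R = r.+1.
  rewrite (degU true w wZ) -addn1; congr (_ + _); apply/eqP/cards1P; exists u.
  by rewrite Qu; apply/setIidPr; rewrite sub1set inE uz.
(* All of [Z] is adjacent to [u], whose degree is at most the degree [r.+1] of [w]. As degrees
   inside [Z] are [r], this makes [Z] a clique. *)
have leZ : #|Z| <= r.+1.
  rewrite -Rr -(dM true w wZ); apply: leq_trans (_ : deg true (Z :|: Q) u <= _).
    apply: subset_leq_card; apply/subsetP=> z zZ; rewrite !inE zZ andbT.
    exact: (uz false).
  apply: e_mono; rewrite ?inE ?wZ ?Qu ?inE ?eqxx ?orbT //; last exact: (uz true).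
  suff -> : (Z :|: [set u]) :\ u = Z by [].
  by rewrite setUC setU1K.
exists u => // x y; rewrite !in_setU1 => /orP[/eqP->|xZ] /orP[/eqP->|yZ] xy.
- by rewrite eqxx in xy.
- exact: (uz true).
- exact: (uz false).
have : nb true y :&: Z = Z :\ y.
  apply/eqP; rewrite eqEcard; apply/andP; split.
    apply/subsetP=> z; rewrite !inE => /andP[zy ->]; rewrite andbT.
    by apply: contraTneq zy => ->; rewrite /= e_irr.
  by have := dZ true y yZ; rewrite /deg => ->; move: leZ; rewrite (cardsD1 y) yZ.
by move/setP/(_ x); rewrite !inE xZ xy => /andP[].
Qed.

(** Each extension is a clique and therefore again a valid [Z], so it can be repeated until no
    vertex is left outside. *)
Lemma biconn_complete Z : regular_biconn Z -> Z != setT ->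
  forall x y, x != y -> e x y.
Proof.
have [n leZn] := ubnP (#|T| - #|Z|); elim: n => // n IH in Z leZn *.
move=> bZ ZT; have [u uZ cl] := biconn_extend bZ ZT.
have Z3 : 2 < #|u |: Z| by case: bZ => ? _ _ _; rewrite cardsU1 uZ leqW.
case: (eqVneq (u |: Z) setT) => [uT x y|uT].
  by move=> xy; apply: cl => //; rewrite uT inE.
apply: (IH (u |: Z)) => //; last exact: clique_regular_biconn.
apply: leq_trans (_ : _ < #|T| - #|Z|) _; last by rewrite -ltnS.
by rewrite ltn_sub2l ?cardsU1 ?uZ //
   (leq_trans _ (max_card (u |: Z))) // cardsU1 uZ.
Qed.

End Connected.
End DegMonotone.

(** * Short directed cycles *)

Lemma index_next (T : eqType) (p : seq T) x : uniq p -> x \in p ->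
  index (next p x) p = (index x p).+1 %% size p.
Proof.
move=> up xp; rewrite next_nth xp; case: p up xp => // y p up xp.
have : index x (y :: p) < size (y :: p) by rewrite index_mem.
(* [next] reads position [i] of the tail with default [y], the head, so the last element wraps
   around. *)
set i := index x _; rewrite [size _]/= ltnS leq_eqVlt => /orP[/eqP-> /=|ip].
  by rewrite nth_default // eqxx modnn.
have -> : nth y p i = nth y (y :: p) i.+1 by [].
by rewrite index_uniq ?modn_small.
Qed.

Lemma next_bij (T : finType) (p : seq T) :
  uniq p -> (forall x, x \in p) -> exists2 f : T -> 'I_(size p), bijective f &
  forall x y, (f y == ordS (f x)) = (y == next p x).
Proof.
move=> up allp; have lt x : index x p < size p by rewrite index_mem.
exists (fun x => Ordinal (lt x)).
  apply: inj_card_bij => [x y [/index_inj]|]; first exact.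
  by rewrite card_ord -(card_uniqP up) max_card.
move=> x y; rewrite -val_eqE /= -index_next //.
by apply/eqP/eqP=> [/index_inj|->]; first exact.
Qed.

Section Cycles.
Variables (T : finType) (e : rel T).
Hypothesis e_irr : irreflexive e.
Local Notation nb := (nb e).

(** Paths are extended backwards at their first vertex [x]. Either this never stops, or all
    in-neighbours of [x] lie on the path and a far one closes a long cycle. *)
Lemma long_ucycle j (x0 : T) : 0 < j -> (forall v, j <= #|nb true v|) ->
  exists2 p, ucycle e p & j < size p.
Proof.
move=> j0 dj; apply: contrapT => nex.
have long n : exists x p, [/\ uniq (x :: p), path e x p & size p = n].
  elim: n => [|n [x [p [up ep sp]]]]; first by exists x0, [::].
  case: (boolP (nb true x \subset x :: p)) => [nbp|/subsetPn[y]]; last first.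
    rewrite inE => yx yp; exists y, (x :: p); split; rewrite /= ?sp //.
      by rewrite yp; move: up => /= ->.
    by rewrite ep andbT.
  (* The first [j.-1] vertices after [x] cannot hold all [j] in-neighbours; one further along closes
     a cycle with more than [j] vertices. *)
  case: nex; have /subsetPn[y yx yt] : ~~ (nb true x \subset take j.-1 p).
    apply/negP=> /subset_leq_card; apply/negP; rewrite -ltnNge.
    apply: leq_trans (dj x); apply: leq_ltn_trans (card_size _) _.
    by rewrite size_take_min (leq_ltn_trans (geq_minl _ _)) // prednK.
  have yp : y \in p.
    have := subsetP nbp y yx; rewrite in_cons => /orP[/eqP xy|//].
    by move: yx; rewrite xy inE /= e_irr.
  rewrite inE /= in yx; case/path.splitP: yp up ep yt {nbp sp} => p1 p2 up ep yt.
  exists (x :: rcons p1 y); last first.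
    rewrite /= size_rcons ltnS -(prednK j0) ltnS leqNgt.
    apply: contra yt => lt1; rewrite take_cat size_rcons ltnNge lt1 /=.
    by rewrite mem_cat mem_rcons mem_head.
  apply/andP; split.
    rewrite /cycle rcons_path last_rcons yx andbT.
    by move: ep; rewrite cat_path => /andP[].
  by move: up; rewrite -cat_cons cat_uniq => /andP[].
have [x [p [/card_uniqP/= card_p _ sp]]] := long #|T|.
by have := max_card [in x :: p]; rewrite card_p sp ltnn.
Qed.

(* A chord of a directed cycle, other than the reverse of one of its arcs,
   shortcuts it into a cycle of length at least 3. *)
Lemma chordless_ucycle p : ucycle e p -> 2 < size p ->
  exists p', [/\ ucycle e p', 2 < size p' &
    {in p' &, forall x y, e x y -> (y == next p' x) || (x == next p' y)}].
Proof.
have [n lepn] := ubnP (size p); elim: n => // n IH in p lepn *.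
move=> cp p3; apply: contrapT => nex; apply: (nex); exists p; split=> // x y xp yp.
move=> xy; apply/negPn/negP=> nxy; have [i q rotp] := rot_to xp.
have /andP[_ up] := cp.
move: cp p3 lepn yp nxy; rewrite -(rot_ucycle i) -(size_rot i) -(mem_rot i).
rewrite -2!(next_rot i up) rotp in_cons => cp p3 lepn /orP[/eqP yx|yq].
  by rewrite yx e_irr in xy.
(* With [x] in front, [y] is its successor if nothing stands between them and its predecessor if
   nothing follows [y]. Otherwise the chord skips [z] and the cycle still contains [w]. *)
case/splitPr: q / yq rotp cp p3 lepn => [[|z q1] q2] _ /andP[ep uq] p3 lepn.
  by rewrite /= eqxx eqxx.
case: q2 => [|w q2] in ep uq p3 lepn *.
  have yq1 : y \notin x :: z :: q1.
    by move: uq; rewrite -cat_cons cat_uniq /= orbF => /and3P[].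
  rewrite negb_or => /andP[_]; rewrite next_nth -cat_cons mem_cat mem_head orbT.
  rewrite index_cat (negPf yq1) /= eqxx addn0 nth_default ?eqxx //.
  by rewrite size_cat /= addn1.
case: (IH (x :: y :: w :: q2)) => //.
- rewrite -ltnS; apply: leq_trans lepn; rewrite /= size_cat /= !ltnS.
  by rewrite !addnS !ltnS leq_addl.
- apply/andP; split.
    by move: ep; rewrite /= xy rcons_cat cat_path /= => /and5P[_ _ _ -> ->].
  move: uq; rewrite (cons_uniq x) mem_cat negb_or cat_uniq => /andP[/andP[_ xq]].
  by case/and3P=> _ _ uq; rewrite (cons_uniq x) xq.
by move=> p' cp' _; case: nex; exists p'.
Qed.

(** After rotating [z] to the front, the remaining vertices form a path. *)
Lemma conn_ucycle p : ucycle e p ->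
  conn e [set x in p] /\ forall z, z \in p -> conn e ([set x in p] :\ z).
Proof.
move=> cp; have conn_rot z : z \in p ->
    conn e [set x in p] /\ conn e ([set x in p] :\ z).
  move=> zp; have [i q rotp] := rot_to zp.
  have eqp : [set x in p] = [set x in z :: q].
    by apply/setP=> x; rewrite !inE -in_cons -rotp mem_rot.
  move: cp; rewrite -(rot_ucycle i) rotp => /andP[+ uq].
  rewrite /cycle rcons_path => /andP[eq _]; rewrite eqp; split.
    exact: conn_path eq.
  have -> : [set x in z :: q] :\ z = [set x in q].
    move: uq => /= /andP[zq _]; apply/setP=> x; rewrite !inE.
    by case: eqP => [->|//]; rewrite (negPf zq).
  case: q eq {uq eqp rotp} => [_ A|y q /andP[_ /conn_path//]].
  have -> : [set x in [::]] = set0 :> {set T} by apply/setP=> x; rewrite !inE.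
  by rewrite subset0 => /eqP->; rewrite eqxx.
split=> [|z /conn_rot[]//]; case: p cp conn_rot => [|z p] _ conn_rot.
  move=> A; have -> : [set x in [::]] = set0 :> {set T}.
    by apply/setP=> x; rewrite !inE.
  by rewrite subset0 => /eqP->; rewrite eqxx.
by have [] := conn_rot z (mem_head _ _).
Qed.

(** * Regular digraphs: directed cycles, bidirected cycles, complete digraphs *)

Section Regular.
Variable k : nat.
Hypotheses (e_mono : deg_monotone e) (e_reg : forall b v, #|nb b v| = k).
Hypothesis connT : conn e setT.

(** [deg_const] applies with both sets equal to the cycle: each vertex has its predecessor and its
    successor there. *)
Lemma ucycle_regular_biconn p : ucycle e p -> 2 < size p ->
  regular_biconn e [set x in p].
Proof.
move=> cp p3; have [cZ cZ1] := conn_ucycle cp; have [ep up] := andP cp.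
have dZ b z : z \in [set x in p] -> 0 < deg e b [set x in p] z.
  rewrite inE => zp; apply/card_gt0P; case: b.
    exists (prev p z); rewrite !inE mem_prev zp andbT.
    exact: (prev_cycle ep).
  exists (next p z); rewrite !inE mem_next zp andbT.
  exact: (next_cycle ep).
have cZ1' z : z \in [set x in p] -> conn e ([set x in p] :\ z).
  by rewrite inE; apply: cZ1.
have [r dr] := deg_const e_mono (subxx _) cZ cZ1' dZ.
split=> //; first by rewrite cardsE (card_uniqP up).
exists r => //; case: p p3 dr dZ {cp ep up cZ cZ1 cZ1'} => // x p _ dr dZ.
by rewrite -(dr true x) ?dZ // inE mem_head.
Qed.

(** The unique arcs into and out of a vertex of a cycle belong to the cycle, so its vertex set is
    closed under adjacency. *)
Lemma regular1_dicycle (x0 : T) : k = 1 -> exists p, [/\ uniq p, 1 < size p,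
  forall x, x \in p & forall x y, e x y = (y == next p x)].
Proof.
move=> k1; have [|v|p cp p1] := @long_ucycle 1 x0; rewrite ?e_reg ?k1 //.
have [ep up] := andP cp; exists p.
have nbE b x y y' : dir e b y x -> dir e b y' x -> y = y'.
  move=> yx y'x; apply: (card_le1_eqP (A := mem (nb b x))); rewrite ?inE //.
  by rewrite e_reg k1.
have nxt x y : x \in p -> e x y -> y = next p x.
  by move=> xp xy; apply: (@nbE false x) => //; apply: (next_cycle ep).
have prv x y : x \in p -> e y x -> y = prev p x.
  by move=> xp xy; apply: (@nbE true x) => //; apply: (prev_cycle ep).
have pT : [set x in p] = setT.
  apply: (conn_closed connT) => //.
    by apply/set0Pn; case: p p1 {cp ep up nxt prv} => // x p _; exists x;
       rewrite inE mem_head.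
  move=> x y; rewrite !inE => xp _ /orP[/(nxt x y xp)->|/(prv x y xp)->].
    by rewrite mem_next.
  by rewrite mem_prev.
have allp x : x \in p by have := in_setT x; rewrite -pT inE.
split=> // x y; apply/idP/eqP => [/nxt->//|->]; exact: next_cycle.
Qed.

Lemma regular_cases (x0 : T) : 1 < k -> (forall x y, x != y -> e x y) \/
  exists p, [/\ uniq p, 2 < size p, forall x, x \in p &
    forall x y, e x y = (y == next p x) || (x == next p y)].
Proof.
move=> k2; have [|v|p0 cp0 p03] := @long_ucycle 2 x0; rewrite ?e_reg //.
have [p [cp p3 chp]] := chordless_ucycle cp0 p03.
have bZ := ucycle_regular_biconn cp p3; have [ep up] := andP cp.
case: (eqVneq [set x in p] setT) => [pT|]; last first.
  by move=> pT; left; apply: (biconn_complete e_irr e_mono e_reg connT bZ).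
have allp x : x \in p by have := in_setT x; rewrite -pT inE.
right; exists p; split=> // x y; apply/idP/idP => [|/orP[]/eqP].
- exact: chp.
- by move=> ->; apply: next_cycle.
(* Chordlessness allows only [next p x] and [prev p x] as out-neighbours of [x], and [1 < k] makes
   both occur: all reverse arcs are present. *)
move=> xy; have yE : y = prev p x by rewrite xy prev_next.
have sub : nb false x \subset [set next p x; prev p x].
  apply/subsetP=> z; rewrite !inE /= => /chp-/(_ (allp _) (allp _)).
  by case/orP=> [->//|/eqP->]; rewrite prev_next ?eqxx ?orbT.
have : y \in nb false x; last by rewrite inE.
suff -> : nb false x = [set next p x; prev p x] by rewrite yE !inE eqxx orbT.
apply/eqP; rewrite eqEcard sub e_reg cards2; apply: leq_trans k2.
by case: (_ != _).
Qed.

End Regular.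
End Cycles.

(** * Selections with a hole *)

Section Selections.
Variables (D : digraph) (C : DPcover D).
Implicit Types (t : D -> C) (u v w : D) (S M U : {set D}) (x y c : C).
Local Notation fib := (cov_fib C).
Local Notation adj := (adj (@darc D)).
Local Notation nb := (nb (@darc D)).

Lemma cov_dir b x y u v : x \in fib u -> y \in fib v ->
  dir (@darc C) b x y -> dir (@darc D) b u v.
Proof.
move=> xu yv xy; have [x1 [y1 [x1u y1v x1y1]]] : exists x1 y1,
    [/\ x1 \in fib (if b then u else v), y1 \in fib (if b then v else u) &
    darc x1 y1] by case: b xy => xy; [exists x, y|exists y, x].
have [u1 [v1 [uv1 x1u1 y1v1]]] := cov_arc x1y1.
move: uv1; rewrite -(cov_fib_inj x1u x1u1) -(cov_fib_inj y1v y1v1).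
by case: b {xy x1u y1v}.
Qed.

Lemma cov_dir_inj b x y y' v : y \in fib v -> y' \in fib v ->
  dir (@darc C) b x y -> dir (@darc C) b x y' -> y = y'.
Proof.
move=> yv y'v xy xy'; have [u xu] := cov_full x.
have uv := cov_dir xu yv xy; apply/eqP/negPn/negP=> nyy'.
case: b xy xy' uv => xy xy' uv.
  have := @cov_match _ C _ _ uv (x, y) (x, y').
  rewrite !inE /= xu yv y'v /= => /(_ xy xy').
  rewrite xpair_eqE eqxx nyy' => /(_ isT) /disjointFr/(_ (set21 _ _)).
  by rewrite !inE eqxx.
have := @cov_match _ C _ _ uv (y, x) (y', x).
rewrite !inE /= xu yv y'v /= => /(_ xy xy').
rewrite xpair_eqE eqxx andbT nyy' => /(_ isT) /disjointFr/(_ (set22 _ _)).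
by rewrite !inE eqxx orbT.
Qed.

Definition selection t := forall v, t v \in fib v.

(** A selection is injective, so cycles among its colours can be listed by vertices of [D]. A
    partial transversal is a total function read only on [S]. *)
Definition acyclic_sel t S := forall p : seq D, p != [::] -> {subset p <= S} ->
  ~ ucycle (fun u w => darc (t u) (t w)) p.

Definition update t v c : D -> C := fun u => if u == v then c else t u.

Lemma update_selection t v c :
  selection t -> c \in fib v -> selection (update t v c).
Proof. by move=> st cv u; rewrite /update; case: eqP => [->|]. Qed.

Lemma acyclic_sel_eq t t' S : {in S, t =1 t'} -> acyclic_sel t S ->
  acyclic_sel t' S.
Proof.
move=> tt' act p p0 pS cp; apply: (act p p0 pS).
rewrite /ucycle -(eq_in_cycle (P := mem p) (e := fun u w => darc (t' u) (t' w))) //.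
by move=> u w /pS uS /pS wS; rewrite !tt'.
Qed.

(** A cycle through [v] both enters and leaves [v], so it is enough to exclude the arcs on one
    side. *)
Lemma acyclic_selU1 b t S v : acyclic_sel t S ->
  (forall u, u \in S -> ~~ dir (@darc C) b (t u) (t v)) ->
  acyclic_sel t (v |: S).
Proof.
move=> act nov p p0 pS cp; have [ep up] := andP cp.
case: (boolP (v \in p)) => vp; last first.
  apply: (act p) => // u up'; have := pS u up'.
  by rewrite in_setU1; case: eqP vp => // <-; rewrite up'.
have [w wp wv] : exists2 w, w \in p & dir (@darc C) b (t w) (t v).
  case: b {nov}; first by exists (prev p v); [rewrite mem_prev|apply: (prev_cycle ep)].
  by exists (next p v); [rewrite mem_next|apply: (next_cycle ep)].
have := pS w wp; rewrite in_setU1 => /orP[/eqP wv'|/nov/negP//].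
by move: wv; rewrite wv' /dir; case: b {nov}; rewrite darc_irr.
Qed.

(** By the matching condition, each neighbour on side [b] excludes at most one colour of [v]. *)
Lemma free_color b t S v : selection t -> #|nb b v :&: S| < #|fib v| ->
  exists2 c, c \in fib v & forall u, u \in S -> ~~ dir (@darc C) b (t u) c.
Proof.
move=> st; rewrite ltnNge => /negP lt; apply: contrapT => nex; apply: lt.
apply: (leq_card_rel (r := fun c u => c \in fib v /\ dir (@darc C) b (t u) c)).
  move=> c cv; apply: contrapT => nu; apply: nex; exists c => // u uS.
  apply/negP=> uc; apply: nu; exists u => //; rewrite !inE uS andbT.
  exact: cov_dir uc.
by move=> c c' u _ _ [cv uc] [c'v uc']; exact: (cov_dir_inj cv c'v uc uc').
Qed.

Lemma extend_selection b t S v : selection t -> acyclic_sel t S -> v \notin S ->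
  #|nb b v :&: S| < #|fib v| ->
  exists2 t', selection t' & acyclic_sel t' (v |: S).
Proof.
move=> st act vS /(free_color st)[c cv free].
have tS : {in S, t =1 update t v c}.
  by move=> u uS; rewrite /update; case: eqP vS => // <-; rewrite uS.
exists (update t v c); first exact: update_selection.
apply: (@acyclic_selU1 b); first exact: acyclic_sel_eq act.
by move=> u uS; rewrite -tS // /update eqxx free.
Qed.

Definition hole t v := selection t /\ acyclic_sel t (~: [set v]).

(** * Greedy colouring towards a hole *)

Section Greedy.
Variable k : nat.
Hypotheses (k0 : 0 < k) (fibk : forall v, k <= #|fib v|).
Hypotheses (nbk : forall b v, #|nb b v| <= k) (connT : conn (@darc D) setT).

(** Each vertex [u] is coloured while it still has an uncoloured neighbour [w]; on the side of [w],
    fewer than [k] neighbours of [u] exclude a colour. *)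
Lemma exists_hole v : exists t, hole t v.
Proof.
suff ex U : U != set0 -> exists2 t, selection t & acyclic_sel t (~: U).
  have [t st act] : exists2 t, selection t & acyclic_sel t (~: [set v]).
    by apply: ex; apply/set0Pn; exists v; rewrite inE.
  by exists t.
have [n leUn] := ubnP #|~: U|; elim: n => // n IH in U leUn *.
move=> U0; case: (eqVneq U setT) => [->|UT].
  have /choice[t st] u : exists c, c \in fib u.
    by apply/card_gt0P; apply: leq_trans (fibk u).
  exists t => // p p0; rewrite setCT; case: p p0 => // w p _ /(_ w (mem_head _ _)).
  by rewrite inE.
have [w [u [wU _ uU wu]]] := connT (subsetT U) U0 UT.
have [||t st act] := IH (u |: U).
- rewrite -ltnS; apply: leq_trans leUn.
  by rewrite !ltnS setCU [X in _ < X](cardsD1 u) inE uU setDE setIC.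
- by apply/set0Pn; exists u; rewrite !inE eqxx.
have [b dwu] := adj_dir wu.
have -> : ~: U = u |: ~: (u |: U).
  by apply/setP=> z; rewrite !inE; case: eqP => [->|//]; rewrite uU.
apply: (@extend_selection b t) => //; first by rewrite !inE eqxx.
apply: leq_trans (fibk u); apply: leq_trans (nbk b u).
apply: proper_card; apply/properP; split; first exact: subsetIl.
by exists w; rewrite ?inE // wU orbT andbF.
Qed.

(** * Moving the hole in an uncolorable cover *)

Section Uncolorable.
Hypothesis uncol : forall t, selection t -> ~ acyclic_sel t setT.

(** A colour of [v] free on one side would complete the selection. *)
Lemma blocked b t v c : hole t v -> c \in fib v ->
  exists2 u, u \in nb b v & dir (@darc C) b (t u) c.
Proof.
move=> [st act] cv; apply: contrapT => nu.
apply: (uncol (update_selection st cv)).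
have -> : setT = v |: ~: [set v] by rewrite setUCr.
have tS : {in ~: [set v], t =1 update t v c}.
  by move=> u; rewrite !inE /update => /negPf->.
apply: (@acyclic_selU1 b); first exact: acyclic_sel_eq act.
move=> u uv; rewrite -tS // /update eqxx; apply/negP=> uc.
by apply: nu; exists u => //; rewrite inE; apply: cov_dir uc.
Qed.

Lemma card_nb_ge b t v (N : {set D}) :
  (forall c, c \in fib v -> exists2 u, u \in N & dir (@darc C) b (t u) c) ->
  k <= #|N|.
Proof.
move=> ex; apply: leq_trans (fibk v) _.
apply: (leq_card_rel (r := fun c u => c \in fib v /\ dir (@darc C) b (t u) c)).
  by move=> c cv; have [u uN uc] := ex c cv; exists u.
by move=> c c' u _ _ [cv uc] [c'v uc']; exact: (cov_dir_inj cv c'v uc uc').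
Qed.

Lemma card_nb b v : #|nb b v| = k.
Proof.
have [t ht] := exists_hole v; apply/eqP; rewrite eqn_leq nbk /=.
by apply: (@card_nb_ge b t v) => // c; apply: blocked.
Qed.

Lemma card_fib v : #|fib v| = k.
Proof.
have [t ht] := exists_hole v; apply/eqP; rewrite eqn_leq fibk andbT.
rewrite -(card_nb true v).
apply: (leq_card_rel (r := fun c u => c \in fib v /\ dir (@darc C) true (t u) c)).
  by move=> c cv; have [u uN uc] := blocked true ht cv; exists u.
by move=> c c' u _ _ [cv uc] [c'v uc']; exact: (cov_dir_inj cv c'v uc uc').
Qed.

Lemma nb_proper_card b v u : u \in nb b v -> ~ k <= #|nb b v :\ u|.
Proof. by move=> uv; rewrite -(card_nb b v) (cardsD1 u) uv ltnn. Qed.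

(** A neighbour blocking no colour could be dropped, and [k] colours would be blocked by [k.-1]
    neighbours. The same count gives [blocks_inj], so neighbours and colours correspond bijectively
    on each side. *)
Lemma blocks b t v u : hole t v -> u \in nb b v ->
  exists2 c, c \in fib v & dir (@darc C) b (t u) c.
Proof.
move=> ht uv; apply: contrapT => nc; apply: (nb_proper_card uv).
apply: (card_nb_ge (b := b) (t := t) (v := v)) => c cv; have [w wv wc] := blocked b ht cv.
exists w => //; rewrite in_setD1 wv andbT; apply/eqP=> wu.
by apply: nc; exists c; rewrite -?wu.
Qed.

Lemma blocks_inj b t v u u' c : hole t v -> u \in nb b v -> u' \in nb b v ->
  c \in fib v -> dir (@darc C) b (t u) c -> dir (@darc C) b (t u') c -> u = u'.
Proof.
move=> ht uv u'v cv uc u'c; apply/eqP/negPn/negP=> nuu'.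
apply: (nb_proper_card u'v); apply: (card_nb_ge (b := b) (t := t) (v := v)) => c' c'v.
have [w wv wc'] := blocked b ht c'v; case: (eqVneq w u') => wu'; last first.
  by exists w => //; rewrite in_setD1 wu'.
exists u; first by rewrite in_setD1 nuu'.
by rewrite -(cov_dir_inj cv c'v u'c) // -wu'.
Qed.

(** On side [b] only [u] blocks [c], so [v] can take [c] once [u] is uncoloured. *)
Lemma shift_hole b t v u : hole t v -> u \in nb b v ->
  exists c, [/\ c \in fib v, dir (@darc C) b (t u) c & hole (update t v c) u].
Proof.
move=> ht uv; have [c cv uc] := blocks ht uv; have [st act] := ht.
have nuv : u != v.
  apply/eqP=> equv; move: uv; rewrite equv inE /dir; case: b {uc};
  by rewrite darc_irr.
exists c; split=> //; split; first exact: update_selection.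
have -> : ~: [set u] = v |: ~: [set u; v].
  apply/setP=> w; rewrite !inE negb_or; case: (w =P v) => [->|_].
    by rewrite eq_sym nuv.
  by rewrite andbT.
have tS : {in ~: [set u; v], t =1 update t v c}.
  by move=> w; rewrite !inE negb_or /update => /andP[_ /negPf->].
apply: (@acyclic_selU1 b).
  apply: (acyclic_sel_eq tS) => p p0 pS; apply: act => // w /pS.
  by rewrite !inE negb_or => /andP[].
move=> w wS; rewrite -tS // /update eqxx; apply/negP=> wc.
move: wS; rewrite !inE (@blocks_inj b t v w u c) ?eqxx // inE.
exact: cov_dir wc.
Qed.

Lemma walk_hole t M q p : conn (@darc D) M -> q \in M -> p \in M -> hole t q ->
  exists2 t', hole t' p & forall w, w \notin M -> t' w = t w.
Proof.
move=> cM qM pM hq; pose P u := exists2 t', hole t' u &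
  forall w, w \notin M -> t' w = t w.
suff : p \in [set u in M | `[< P u >]] by rewrite inE => /andP[_ /asboolP].
suff -> : [set u in M | `[< P u >]] = M by [].
apply: (conn_closed cM).
- by apply/subsetP=> u; rewrite inE => /andP[].
- by apply/set0Pn; exists q; rewrite inE qM; apply/asboolP; exists t.
move=> u w; rewrite !inE => /andP[uM /asboolP[t' hu t'M]] wM.
rewrite adjC wM => /adj_dir[b wu]; apply/asboolP.
have [|c [_ _ hw]] := @shift_hole b _ _ w hu; first by rewrite inE.
exists (update t' u c) => // z zM; rewrite /update.
by case: eqP zM => [->|_ /t'M//]; rewrite uM.
Qed.

(* Give the hole [v] the colour blocked by a neighbour [q] in [M] and walk the
   hole from [q] to [p] inside [M :\ v]. There [v] blocks a colour of [p] that no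
   neighbour outside [M] blocks, and different [q] yield different colours. *)
Lemma uncolorable_deg_monotone : deg_monotone (@darc D).
Proof.
move=> b b' M v p vM pM cMv vp; have [t ht] := exists_hole v.
have pMv : p \in M :\ v.
  rewrite in_setD1 pM andbT; apply/eqP=> pv; move: vp; rewrite pv /dir.
  by case: b'; rewrite darc_irr.
have vbp : v \in nb b' p by rewrite inE.
have walk q : q \in nb b v :&: M -> exists c t', [/\ c \in fib v,
    dir (@darc C) b (t q) c, hole t' p, t' v = c &
    forall w, w \notin M -> t' w = t w].
  rewrite inE => /andP[qv qM]; have [c [cv qc hq]] := shift_hole ht qv.
  have qMv : q \in M :\ v.
    rewrite in_setD1 qM andbT; apply/eqP=> eqv; move: qv; rewrite eqv inE /dir.
    by case: b {qc}; rewrite darc_irr.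
  have [t' hp t'M] := walk_hole cMv qMv pMv hq; exists c, t'; split=> //.
    by rewrite t'M ?in_setD1 ?eqxx // /update eqxx.
  move=> w wM; rewrite t'M ?in_setD1 ?negb_and ?wM ?orbT // /update.
  by case: eqP wM => [->|//]; rewrite vM.
case: (set_0Vmem (nb b v :&: M)) => [E|[q0 q0M]]; first by rewrite /deg E cards0.
(* Outside [M] every selection obtained by walking agrees with [t], so [R] is the same for all [q]:
   the colours of [p] that must be blocked from inside [M]. *)
pose R := [set y in fib p | [forall u in nb b' p :\: M,
  ~~ dir (@darc C) b' (t u) y]].
have leR : deg (@darc D) b M v <= #|R|.
  apply: (leq_card_rel (r := fun q y => exists c, [/\ c \in fib v,
    dir (@darc C) b (t q) c & dir (@darc C) b' c y])).
    move=> q /walk[c [t' [cv qc hp t'v t'M]]].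
    have [y yp vy] := blocks hp vbp; exists y; last by exists c; rewrite -{3}t'v.
    rewrite inE yp; apply/forall_inP=> u; rewrite inE => /andP[uM ubp].
    apply/negP; rewrite -t'M // => uy.
    by move: uM; rewrite (blocks_inj hp ubp vbp yp uy vy) vM.
  (* The matching between the fibres of [v] and [p] recovers [c] from [y], and [c] determines [q]
     because [t] has its hole at [v]. *)
  move=> q q' y; rewrite !inE => /andP[qv _] /andP[q'v _].
  move=> [c [cv qc cy]] [c' [c'v q'c' c'y]].
  have cc' : c = c'.
    by apply: (@cov_dir_inj (~~ b') y c c' v); rewrite ?dirNE.
  by rewrite -cc' in q'c'; apply: (blocks_inj ht _ _ cv qc q'c'); rewrite inE.
have [c [t' [_ _ hp _ t'M]]] := walk q0 q0M.
have leN : #|nb b' p :\: M| <= #|fib p :\: R|.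
  apply: (leq_card_rel (r := fun u y => y \in fib p /\
    dir (@darc C) b' (t' u) y)).
    move=> u uN; have := uN; rewrite inE => /andP[uM ubp].
    have [y yp uy] := blocks hp ubp; exists y => //.
    rewrite !inE yp andbT /=; apply/negP=> /forall_inP/(_ u uN).
    by rewrite -t'M // uy.
  move=> u u' y; rewrite !inE => /andP[_ ubp] /andP[_ u'bp] [yp uy] [_ u'y].
  by apply: (blocks_inj hp _ _ yp uy u'y); rewrite inE.
have Rfib : R \subset fib p by apply/subsetP=> y; rewrite inE => /andP[].
(* Neighbours and colours of [p] both number [k]; adding the bound for those outside [M] turns the
   claim into this equality. *)
apply: leq_trans leR _; rewrite -(leq_add2r #|nb b' p :\: M|) /deg cardsID.
apply: leq_trans (leq_add (leqnn _) leN) _.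
by rewrite card_nb -(card_fib p) -(cardsID R (fib p)) (setIidPr Rfib).
Qed.

End Uncolorable.
End Greedy.

Lemma acyclic_transversal_sel t : selection t -> acyclic_sel t setT ->
  acyclic_transversal (t @: setT).
Proof.
move=> st act; split=> [v|p p0 pT cp].
  apply/eqP/cards1P; exists (t v); apply/setP=> x; rewrite !inE.
  apply/andP/eqP=> [[/imsetP[u _ ->] tuv]|->].
    by rewrite (cov_fib_inj (st u) tuv).
  by rewrite imset_f ?inE.
have [q pq] : exists q, p = map t q.
  elim: p pT {p0 cp} => [_|x p IH pT]; first by exists [::].
  have [y yp|q ->] := IH; first by apply: pT; rewrite in_cons yp orbT.
  have /imsetP[u _ ->] := pT x (mem_head _ _); by exists (u :: q).
apply: (act q).
- by case: q pq p0 => // ->.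
- by move=> u; rewrite inE.
move: cp; rewrite pq /ucycle cycle_map => /andP[cq uq]; apply/andP; split=> //.
exact: map_uniq uq.
Qed.

Lemma sel_acyclic_transversal (A : {set C}) : acyclic_transversal A ->
  exists2 t, selection t & acyclic_sel t setT.
Proof.
move=> [A1 acA]; have /choice[t tA] v : exists x, x \in A :&: fib v.
  by apply/card_gt0P; rewrite A1.
have st : selection t by move=> v; have := tA v; rewrite inE => /andP[].
exists t => // p p0 _ /andP[cp up]; apply: (acA (map t p)).
- by case: p p0 {cp up}.
- by move=> x /mapP[u _ ->]; have := tA u; rewrite inE => /andP[].
apply/andP; split; first by rewrite cycle_map.
rewrite map_inj_uniq // => u v tuv; apply: (@cov_fib_inj _ C _ (t u)) => //.
by rewrite tuv.
Qed.

End Selections.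

(** * Covers by permutations and the DP-chromatic number *)

Section PermutationCover.
Variables (D : digraph) (k : nat) (s : D -> D -> 'I_k -> 'I_k).
Hypothesis s_inj : forall u v, injective (s u v).

(** Along an arc, [s u v] is a perfect matching of the two fibres; opposite arcs may carry unrelated
    permutations. *)
Definition pcov_arc : rel (D * 'I_k)%type :=
  fun x y => darc x.1 y.1 && (y.2 == s x.1 y.1 x.2).

Lemma pcov_irr : irreflexive pcov_arc.
Proof. by move=> x; rewrite /pcov_arc darc_irr. Qed.

Definition pcov_graph := Digraph pcov_irr.

Definition pcov_fib (v : D) : {set pcov_graph} := [set x | x.1 == v].

Lemma pcov_disj u v : u != v -> [disjoint pcov_fib u & pcov_fib v].
Proof.
move=> uv; rewrite -setI_eq0; apply/eqP/setP=> x; rewrite !inE.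
by apply/negP=> /andP[/eqP-> /eqP xv]; rewrite xv eqxx in uv.
Qed.

Lemma pcov_full x : exists v, x \in pcov_fib v.
Proof. by exists x.1; rewrite inE. Qed.

Lemma pcov_indep v : independent (pcov_fib v).
Proof.
move=> x y; rewrite !inE => /eqP xv /eqP yv.
by rewrite /= /pcov_arc xv yv darc_irr.
Qed.

Lemma pcov_match u v : darc u v ->
  matching (arcs_between (pcov_fib u) (pcov_fib v)).
Proof.
move=> uv [[a1 i] [b1 j]] [[a2 i'] [b2 j']]; rewrite !inE /= /pcov_arc /=.
move=> /and3P[/eqP-> /eqP-> /andP[_ /eqP->]].
move=> /and3P[/eqP-> /eqP-> /andP[_ /eqP->]] ne.
have neuv : u != v by apply: contraTneq uv => ->; rewrite darc_irr.
have nei : i != i' by apply: contraNneq ne => ->.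
rewrite -setI_eq0; apply/eqP/setP=> x; rewrite !inE; apply/negP.
move=> /andP[/orP[/eqP->|/eqP->]]; rewrite !xpair_eqE !eqxx ?(negPf neuv) /=.
  by rewrite orbF (negPf nei).
by rewrite eq_sym (negPf neuv) /= (inj_eq (@s_inj u v)) (negPf nei).
Qed.

Lemma pcov_arcP (x y : pcov_graph) : darc x y ->
  exists u v, [/\ darc u v, x \in pcov_fib u & y \in pcov_fib v].
Proof. by case/andP=> xy _; exists x.1, y.1; rewrite !inE !eqxx. Qed.

Definition pcover : DPcover D :=
  Cover pcov_disj pcov_full pcov_indep pcov_match pcov_arcP.

Lemma pcover_uncolorable :
  (forall phi : D -> 'I_k, exists2 p, p != [::] &
     ucycle (fun u v => darc u v && (phi v == s u v (phi u))) p) ->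
  ~ DP_colorable D k.
Proof.
move=> cyc /(_ pcover)[v|A /sel_acyclic_transversal[t st act]].
  have -> : cov_fib pcover v = setX [set v] setT.
    by apply/setP=> -[u i]; rewrite !inE andbT.
  by rewrite cardsX cards1 cardsT card_ord mul1n.
have [p p0 cp] := cyc (fun v => (t v).2); apply: (act p p0) => [u|].
  by rewrite inE.
have tv v : (t v).1 = v by have := st v; rewrite inE => /eqP.
move: cp; rewrite /ucycle; congr (is_true (_ && _)).
by apply: eq_cycle => u v; rewrite /= /pcov_arc !tv.
Qed.

End PermutationCover.

Section Chi.
Variable D : digraph.
Local Notation nb := (nb (@darc D)).

Lemma DPchi_le k : DP_colorable D k -> DPchi D <= k.
Proof. by rewrite /DPchi; case: ex_minnP => m _ minm /asboolP/minm. Qed.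

Lemma DPchi_gt k : ~ DP_colorable D k -> k < DPchi D.
Proof.
move=> nk; rewrite /DPchi; case: ex_minnP => m /asboolP cm _.
rewrite ltnNge; apply/negP=> mk; apply: nk => C leC; apply: cm => v.
exact: leq_trans mk (leC v).
Qed.

Lemma nb_le_max b (v : D) : #|nb b v| <= maxn (max_outdeg D) (max_indeg D).
Proof.
rewrite leq_max; case: b; apply/orP; [right|left].
  exact: (leq_bigmax (F := fun v : D => indeg v)).
exact: (leq_bigmax (F := fun v : D => outdeg v)).
Qed.

Lemma max_le_nb k : (forall b (v : D), #|nb b v| <= k) ->
  maxn (max_outdeg D) (max_indeg D) <= k.
Proof.
move=> le; rewrite geq_max; apply/andP; split; apply/bigmax_leqP => v _.
  exact: (le false v).
exact: (le true v).
Qed.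

Lemma weakly_connected_conn : weakly_connected D -> conn (@darc D) setT.
Proof.
move=> [/card_gt0P[x0 _] cD]; apply: contrapT => /(not_connP x0).
move=> [A [_ A0 AneT _ clA]].
case/set0Pn: A0 => x xA; case/eqP: AneT; apply/setP=> y; rewrite inE.
have cl : closed (fun u v => darc u v || darc v u) (mem A).
  move=> u v uv; apply/idP/idP => [uA|vA]; first by apply: clA uA _ uv.
  by apply: clA vA _ _; rewrite // /adj orbC.
by rewrite -(closed_connect cl (cD x y)).
Qed.

(** With one colour more than the largest degree, the last hole can be filled too. *)
Lemma DP_colorable_max : weakly_connected D ->
  DP_colorable D (maxn (max_outdeg D) (max_indeg D)).+1.
Proof.
move=> cD C leC; have [/card_gt0P[x _] _] := cD.
have [t [st act]] := exists_hole (ltn0Sn _) leC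
  (fun b v => leqW (nb_le_max b v)) (weakly_connected_conn cD) x.
have [||t' st' act'] := @extend_selection D C true t _ x st act.
- by rewrite !inE eqxx.
- apply: leq_trans (leC x); rewrite ltnS; apply: leq_trans (nb_le_max true x).
  exact/subset_leq_card/subsetIl.
exists (t' @: setT); apply: acyclic_transversal_sel => //.
by move: act'; rewrite setUCr.
Qed.

(** * Recognizing the extremal digraphs *)

Lemma complete_iso : (forall x y : D, x != y -> darc x y) ->
  digraph_iso D (bidirected (complete_graph #|D|)).
Proof.
move=> eD; exists (fun x : D => enum_rank x : 'I_#|D|).
  exact: enum_rank_bij.
move=> x y; rewrite /= /complete_rel (inj_eq enum_rank_inj).
by case: eqVneq => [->|/eD->//]; rewrite darc_irr.
Qed.

Lemma dicycle_iso (p : seq D) : uniq p -> (forall x, x \in p) ->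
  (forall x y : D, darc x y = (y == next p x)) ->
  digraph_iso D (dicycle (size p)).
Proof.
move=> up allp eD; have [f bf fE] := next_bij up allp.
exists f => // x y; rewrite eD /= /dicycle_rel fE.
rewrite (inj_eq (bij_inj bf)) andb_idl // -eD => xy.
by apply: contraTneq xy => ->; rewrite darc_irr.
Qed.

Lemma cycle_iso (p : seq D) : uniq p -> (forall x, x \in p) ->
  (forall x y : D, darc x y = (y == next p x) || (x == next p y)) ->
  digraph_iso D (bidirected (cycle_graph (size p))).
Proof.
move=> up allp eD; have [f bf fE] := next_bij up allp.
exists f => // x y; rewrite eD /= /cycle_rel /dicycle_rel !fE.
rewrite !(inj_eq (bij_inj bf)) (eq_sym y x) -andb_orr andb_idl // -eD => xy.
by apply: contraTneq xy => ->; rewrite darc_irr.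
Qed.

Lemma uncolorable_cases : weakly_connected D ->
  ~ DP_colorable D (maxn (max_outdeg D) (max_indeg D)) ->
  [\/ exists2 n, 2 <= n & digraph_iso D (dicycle n),
      exists2 n, 3 <= n & digraph_iso D (bidirected (cycle_graph n))
    | exists n, digraph_iso D (bidirected (complete_graph n))].
Proof.
move=> cD; have [/card_gt0P[x0 _] _] := cD.
have cT := weakly_connected_conn cD; have := nb_le_max.
set k := maxn _ _ => nbk /existsNP[C /not_implyP[leC nocol]].
case: (posnP k) => [k0|k0].
  (* Without arcs, a connected digraph is a single vertex, which is complete. *)
  apply: Or33; exists #|D|; apply: complete_iso => x y xy; exfalso.
  have [||u [v [_ _ _ /adj_dir[b uv]]]] := cT [set x] (subsetT _).
  - by apply/set0Pn; exists x; rewrite inE.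
  - by apply/eqP=> /setP/(_ y); rewrite !inE eq_sym (negPf xy).
  by have := nbk b v; rewrite k0 leqNgt => /negP; apply; apply/card_gt0P;
     exists u; rewrite inE.
have unc (t : D -> C) : selection t -> ~ acyclic_sel t setT.
  by move=> st act; apply: nocol; exists (t @: setT);
     apply: acyclic_transversal_sel.
have mono := uncolorable_deg_monotone k0 leC nbk cT unc.
have reg := card_nb k0 leC nbk cT unc.
have irr := @darc_irr D.
case: (ltngtP k 1) => [|k1|k1]; first by rewrite ltnNge k0.
  have [comp|[p [up p3 allp eD]]] := regular_cases irr mono reg cT x0 k1.
    by apply: Or33; exists #|D|; apply: complete_iso.
  by apply: Or32; exists (size p) => //; apply: cycle_iso.
have [p [up p2 allp eD]] := regular1_dicycle irr reg cT x0 k1.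
by apply: Or31; exists (size p) => //; apply: dicycle_iso.
Qed.

(** * The three families attain the bound *)

Lemma DPchi_eq k : weakly_connected D -> (forall b (v : D), #|nb b v| <= k) ->
  ~ DP_colorable D k -> DPchi D = (maxn (max_outdeg D) (max_indeg D)).+1.
Proof.
move=> cD le nk; apply/eqP; rewrite eqn_leq DPchi_le; last first.
  exact: DP_colorable_max.
by apply: leq_trans (DPchi_gt nk); rewrite ltnS max_le_nb.
Qed.

(** With one colour the cover is a copy of [D], and positive in-degrees yield a directed cycle. *)
Lemma DPchi_dicycle n : weakly_connected D -> 2 <= n ->
  digraph_iso D (dicycle n) ->
  DPchi D = (maxn (max_outdeg D) (max_indeg D)).+1.
Proof.
move=> cD n2 [f [g fK gK] fE]; have [/card_gt0P[x0 _] _] := cD.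
have prE v : darc (g (ord_pred (f v))) v.
  rewrite -fE gK /= /dicycle_rel ord_predK eqxx andbT -val_eqE /=.
  have := ltn_ord (f v); case: (f v : nat) => [|i] ltn.
    by rewrite add0n modn_small; case: n n2 {ltn f g fK gK fE} => [|[]].
  rewrite addSn /= modnDr modn_small ?(ltnW ltn) //.
  by rewrite neq_ltn ltnSn.
apply: (@DPchi_eq 1) => // [b v|].
  rewrite -(cards1 (if b then g (ord_pred (f v)) else g (ordS (f v)))).
  apply/subset_leq_card/subsetP=> u; rewrite !inE; case: b => /=.
    by rewrite -fE => /andP[_ /eqP->]; rewrite ordSK fK.
  by rewrite -fE => /andP[_ /eqP <-]; rewrite fK.
apply: (@pcover_uncolorable D 1 (fun _ _ => id)) => [_ _ i j //|phi].
have [|v|p cp p1] := @long_ucycle _ _ (@darc_irr D) 1 x0 => //.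
  by apply/card_gt0P; exists (g (ord_pred (f v))); rewrite inE; apply: prE.
exists p; first by case: p p1 {cp}.
move: cp; rewrite /ucycle; congr (is_true (_ && _)); apply: eq_cycle => u v.
by rewrite !ord1 eqxx andbT.
Qed.

(** By pigeonhole two vertices share a colour, and their opposite arcs form a directed 2-cycle in
    the cover. *)
Lemma DPchi_complete n : weakly_connected D ->
  digraph_iso D (bidirected (complete_graph n)) ->
  DPchi D = (maxn (max_outdeg D) (max_indeg D)).+1.
Proof.
move=> cD [f bf fE]; have [D0 _] := cD.
have cardD : #|D| = n by rewrite (bij_eq_card bf) card_ord.
have eD (u v : D) : darc u v = (u != v).
  by rewrite -fE /= /complete_rel (bij_eq bf).
apply: (@DPchi_eq n.-1) => // [b v|].
  rewrite -cardD -(cardsC1 v); apply/subset_leq_card/subsetP=> u.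
  by rewrite !inE /dir !eD; case: b; rewrite // eq_sym.
apply: (@pcover_uncolorable D n.-1 (fun _ _ => id)) => [_ _ i j //|phi].
have /injectivePn[u [v uv phiuv]] : ~~ injectiveb phi.
  apply/negP=> /injectiveP/leq_card; rewrite card_ord -cardD.
  by rewrite leqNgt prednK // leqnn.
exists [:: u; v] => //; rewrite /ucycle /= !eD inE uv (eq_sym v) uv phiuv.
by rewrite !eqxx.
Qed.

(** Opposite arcs carry inverse matchings, so matched colours on an edge give a directed 2-cycle.
    Avoiding these, the exchanges force a constant colour from [0] to [n], which the identity on the
    closing edge then matches. *)
Lemma DPchi_cycle n : weakly_connected D -> 3 <= n ->
  digraph_iso D (bidirected (cycle_graph n)) ->
  DPchi D = (maxn (max_outdeg D) (max_indeg D)).+1.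
Proof.
move=> cD; case: n => [//|n] n3 [f [g fK gK] fE].
apply: (@DPchi_eq 2) => // [b v|].
  apply: leq_trans (_ : #|[set g (ordS (f v)); g (ord_pred (f v))]| <= 2).
    apply/subset_leq_card/subsetP=> u; rewrite !inE.
    have -> : dir (@darc D) b u v = cycle_rel (f u) (f v).
      by rewrite /dir; case: b; rewrite -fE //= cycle_sym.
    case/orP=> /andP[_ /eqP E]; last by rewrite -E fK eqxx.
    by rewrite E ordSK fK eqxx orbT.
  by rewrite cards2; case: (_ != _).
pose wrap (u v : D) := [|| (f u == ord0) && (f v == ord_max)
                         | (f u == ord_max) && (f v == ord0)].
pose s u v (i : 'I_2) := if wrap u v then i else rev_ord i.
have wrapC u v : wrap u v = wrap v u.
  by rewrite /wrap orbC; congr (_ || _); rewrite andbC.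
have sK u v : cancel (s u v) (s v u).
  by move=> i; rewrite /s (wrapC v u); case: (wrap u v) => //; rewrite rev_ordK.
have darcC (u v : D) : darc u v = darc v u by rewrite -!fE /= cycle_sym.
apply: (@pcover_uncolorable D 2 s) => [u v|phi]; first exact: can_inj (sK u v).
suff [u [v [uv phiv]]] : exists u v, darc u v /\ phi v = s u v (phi u).
  exists [:: u; v] => //; rewrite /ucycle /= inE uv darcC uv phiv sK !eqxx !andbT.
  by apply: contraTneq uv => ->; rewrite darc_irr.
apply: contrapT => nex.
have step (i j : 'I_n.+1) : j = i.+1 :> nat -> phi (g j) = phi (g i).
  move=> ji; apply/eqP/negPn/negP=> neq; apply: nex; exists (g i), (g j); split.
    rewrite -fE !gK /= /cycle_rel /dicycle_rel -!val_eqE /= ji.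
    by rewrite modn_small -?ji // eqxx ji neq_ltn ltnSn.
  (* Consecutive indices are never the wrapping pair: [0] and [1] are the two ends only for
     [n = 1]. *)
  have -> : s (g i) (g j) (phi (g i)) = rev_ord (phi (g i)).
    rewrite /s /wrap !gK -!val_eqE /= ji; case: ifP => //.
    by case/orP=> /andP[/eqP E /eqP E'] //; move: n3; rewrite -E' E.
  apply/val_inj; move: neq; rewrite -val_eqE /=.
  by case: (phi (g i)) (phi (g j)) => [[|[]]// ?] [[|[]]// ?].
have const m (lt : m < n.+1) : phi (g (Ordinal lt)) = phi (g ord0).
  elim: m lt => [|m IH] lt; first by congr (phi (g _)); apply: val_inj.
  by rewrite (step (Ordinal (ltnW lt))).
apply: nex; exists (g ord_max), (g ord0); split.
  rewrite -fE !gK /= /cycle_rel /dicycle_rel -!val_eqE /= modnn eqxx andbT.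
  by case: n n3 {f g fK gK fE wrap s wrapC sK phi step const}.
by rewrite /s /wrap !gK !eqxx orbT -(const n (ltnSn n)); congr (phi (g _));
   apply: val_inj.
Qed.

End Chi.

Theorem theorem10 (D : digraph) (Dconn : weakly_connected D) :
  DPchi D <= (maxn (max_outdeg D) (max_indeg D)).+1 /\
  (DPchi D = (maxn (max_outdeg D) (max_indeg D)).+1 <->
   [\/ exists2 n, 2 <= n & digraph_iso D (dicycle n),
       exists2 n, 3 <= n & digraph_iso D (bidirected (cycle_graph n))
     | exists n, digraph_iso D (bidirected (complete_graph n))]).
Proof.
split; first exact/DPchi_le/DP_colorable_max.
split=> [chi|[[n n2]|[n n3]|[n]]].
- apply: uncolorable_cases => // /DPchi_le.
  by rewrite chi ltnn.
- exact: DPchi_dicycle.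
- exact: DPchi_cycle.
- exact: DPchi_complete.
Qed.
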